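(* Consider the DC network $$-L_s\dot I_s=R_sI_s+V-u,\qquad -L_t\dot I_t=R_tI_t+\mathcal B^\top V,\qquad C_s\dot V=I_s+\mathcal B I_t-I_l(V),$$ with ZIP-loads $I_l(V)=Z_l^{*-1}V+I_l^*+[V]^{-1}P_l^*$, state $x=(I_s^\top,I_t^\top,V^\top)^\top$ and input $u$, where all data are as described in the context. Assume that, at each node $i=1,\dots,n$, the values $R_{si}$, $L_{si}$ and a number $\pi_i\ge 0$ satisfying $P_{li}^*\le \pi_i$ are available, and let $\Pi=\operatorname{diag}\{\pi_1,\dots,\pi_n\}$. Define the mapping $u_{\mathrm{PBC}}:\mathcal X\to\mathbb R^n$ by $$u_{\mathrm{PBC}}:=R_sI_s+Q_0(x)\dot x,$$ where $Q_0:\mathcal X\to\mathbb R^{n\times(2n+m)}$. Consider the mixed potential function $$\mathcal P(x)=\tfrac12 I_t^\top R_tI_t+I_s^\top V+I_t^\top\mathcal B^\top V-\Big(\tfrac12V^\top Z_l^{*-1}V+\sum_{i=1}^nP_{li}^*\ln V_i+I_l^{*\top}V\Big),$$ and the associated generalized mixed potential function $$\mathcal P_A(x)=\lambda\mathcal P(x)+\tfrac12\nabla_x^\top\mathcal P(x)\,M\,\nabla_x\mathcal P(x),$$ where $\lambda\in\mathbb R$ and the constant symmetric matrix $M\in\mathbb R^{(2n+m)\times(2n+m)}$ are parameters such that $\lambda\mathcal I_{2n+m}+\nabla_x^2\mathcal P(x)M$ has full rank. Then the following statements hold. (i) Let $\upsilon\in\mathbb R^n$ and consider the input $$u=u_{\mathrm{PBC}}+L_s\upsilon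 .$$ The closed-loop system is described by the generalized gradient structure $$Q_A(x)\dot x=\nabla_x\mathcal P_A(x)+\tilde B_A(x)\upsilon$$ with input $\upsilon$ and mixed potential function $\mathcal P$ above, where $$Q_A(x)=(\lambda\mathcal I_{2n+m}+\nabla_x^2\mathcal P(x)M)(Q-\tilde BQ_0(x)),\qquad \tilde B_A(x)=(\lambda\mathcal I_{2n+m}+\nabla_x^2\mathcal P(x)M)\tilde BL_s,$$ with $Q=\operatorname{diag}\{-L_s,-L_t,C_s\}$ and $\tilde B=[-\mathcal I_n\;\;\mathcal O_{n\times m}\;\;\mathcal O_{n}]^\top$. (ii) Let $Q_0(x)=\begin{bmatrix}\mathcal O_n&\mathcal O_{n\times m}&-L_s\Pi[V]^{-2}\end{bmatrix}$. The closed-loop system given by the DC network and the input $u=u_{\mathrm{PBC}}+L_s\upsilon$ is passive with respect to the storage function $\mathcal P_A$ (of the form above) and supply rate $\upsilon^\top\dot V$, for all the trajectories $(I_s,I_t,V)\in\mathcal X$.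
   Context: Network data: $n$ is the number of nodes and $m$ the number of edges (lines) of a connected undirected graph; after labelling the ends of each edge arbitrarily by $+$ and $-$, $\mathcal B\in\mathbb R^{n\times m}$ is the incidence matrix ($\mathcal B_{ik}=+1$ if node $i$ is the positive end of edge $k$, $-1$ if it is the negative end, $0$ otherwise). $L_s,C_s,R_s\in\mathbb R^{n\times n}$ (with diagonal entries $L_{si},C_{si},R_{si}$) and $L_t,R_t\in\mathbb R^{m\times m}$ are positive definite diagonal matrices. The load data are $P_l^*,I_l^*\in\mathbb R^n_{\ge0}$ and a diagonal matrix $Z_l^{*-1}\in\mathbb R^{n\times n}$ with nonnegative diagonal entries $Z_{li}^{*-1}$. The signals are $I_s(t)\in\mathbb R^n$, $I_t(t)\in\mathbb R^m$, $V(t)\in\mathbb R^n$, $u(t)\in\mathbb R^n$. Notation: for $v\in\mathbb R^n$, $[v]:=\operatorname{diag}\{v_1,\dots,v_n\}$. $\mathcal I_k$ is the identity matrix of order $k$; $\mathcal O_{k\times l}$ is the $k\times l$ zero matrix and $\mathcal O_k=\mathcal O_{k\times k}$. $\nabla_x f$ is the column vector of partial derivatives, $\nabla_x^\top f$ its transpose, $\nabla_x^2 f$ the Hessian. $\mathcal X:=\{(I_s,I_t,V)\in\mathbb R^{2n+m}\mid V_i>0\ \text{for all } i\}$. The statement does not single out values of the parameters $\lambda$ and $M$ in $\mathcal P_A$. ''Described by'' means that the closed-loop equations (the network equations with $u=R_sI_s+Q_0(x)\dot x+L_s\upsilon$) can be rewritten as the stated gradient equation. Passivity: a system is passive with respect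 to a storage function $S$ and a supply rate $w$, for all trajectories in a set, if $S\ge0$ on that set and, along every solution of the system evolving in that set, $\frac{d}{dt}S\le w$. *)

(* Defs.v *)
From HB Require Import structures.
From mathcomp Require Import all_boot all_order all_algebra.
From mathcomp Require Import all_classical all_reals all_analysis.

Set Implicit Arguments.
Unset Strict Implicit.
Unset Printing Implicit Defensive.

Import Order.TTheory GRing.Theory Num.Theory.
Import numFieldNormedType.Exports.

Local Open Scope classical_set_scope.
Local Open Scope ring_scope.

Section VectorCalculus.
Variable (R : realType).

Definition gradient N (f : 'cV[R]_N -> R) (x : 'cV[R]_N) : 'cV[R]_N :=
  \col_i 'D_(delta_mx i 0) f x.

Definition hessian N (f : 'cV[R]_N -> R) (x : 'cV[R]_N) : 'M[R]_N :=
  \matrix_(i, j) 'D_(delta_mx i 0) (fun y => 'D_(delta_mx j 0) f y) x.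

(* [v] = diag {v_1, ..., v_n} *)
Definition diagv n (v : 'cV[R]_n) : 'M[R]_n := diag_mx v^T.

Definition posdef n (A : 'M[R]_n) : Prop :=
  forall v : 'cV[R]_n, v != 0 -> 0 < (v^T *m A *m v) 0 0.

Definition posdef_diag n (A : 'M[R]_n) : Prop := is_diag_mx A /\ posdef A.

End VectorCalculus.

(* Edge k has the distinct ends [pos_end k] and [neg_end k], so a connected
   graph on n nodes with m labelled edges; parallel lines are not excluded. *)
Definition adjacent n m (pos_end neg_end : 'I_m -> 'I_n) : rel 'I_n :=
  fun i j => [exists k, ((pos_end k == i) && (neg_end k == j))
                     || ((pos_end k == j) && (neg_end k == i))].

(* s: sources, t: transmission lines, l: loads. [Zlinv] stands for the diagonal
   matrix Z_l^{*-1} as such: its entries may vanish (no impedance load). *)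
Record dc_data (R : realType) (n m : nat) := DcData {
  pos_end : 'I_m -> 'I_n;
  neg_end : 'I_m -> 'I_n;
  Ls : 'M[R]_n;  Cs : 'M[R]_n;  Rs : 'M[R]_n;
  Lt : 'M[R]_m;  Rt : 'M[R]_m;
  Zlinv : 'M[R]_n;
  Il : 'cV[R]_n;
  Pl : 'cV[R]_n;
  nodes_gt0 : (0 < n)%N;
  ends_neq : forall k, pos_end k != neg_end k;
  graph_connected : forall i j, connect (adjacent pos_end neg_end) i j;
  Ls_posdef : posdef_diag Ls;
  Cs_posdef : posdef_diag Cs;
  Rs_posdef : posdef_diag Rs;
  Lt_posdef : posdef_diag Lt;
  Rt_posdef : posdef_diag Rt;
  Zlinv_diag : is_diag_mx Zlinv;
  Zlinv_ge0 : forall i, 0 <= Zlinv i i;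
  Il_ge0 : forall i, 0 <= Il i 0;
  Pl_ge0 : forall i, 0 <= Pl i 0
}.

Section Network.
Variables (R : realType) (n m : nat).

(* x = (I_s, I_t, V) *)
Notation state := 'cV[R]_(n + (m + n)).

Definition cur_s (x : state) : 'cV[R]_n := usubmx x.
Definition cur_t (x : state) : 'cV[R]_m := usubmx (dsubmx x).
Definition volt (x : state) : 'cV[R]_n := dsubmx (dsubmx x).

Definition Xset : set state := [set x | forall i, 0 < volt x i 0].

Variable (G : dc_data R n m).

Definition incidence : 'M[R]_(n, m) :=
  \matrix_(i, k) (if i == pos_end G k then 1
                  else if i == neg_end G k then -1 else 0).

Definition load_current (V : 'cV[R]_n) : 'cV[R]_n :=
  Zlinv G *m V + Il G + invmx (diagv V) *m Pl G.

Definition time_interval (J : set R) : Prop := open J /\ is_interval J.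

Definition evolves_in N (D : set 'cV[R]_N) (J : set R) (x : R -> 'cV[R]_N)
    : Prop :=
  forall t, J t -> derivable x t 1 /\ D (x t).

Definition dc_network (J : set R) (u : R -> 'cV[R]_n) (x : R -> state) : Prop :=
  forall t, J t ->
  [/\ - (Ls G *m derive1 (cur_s \o x) t)
        = Rs G *m cur_s (x t) + volt (x t) - u t,
      - (Lt G *m derive1 (cur_t \o x) t)
        = Rt G *m cur_t (x t) + incidence^T *m volt (x t) &
      Cs G *m derive1 (volt \o x) t
        = cur_s (x t) + incidence *m cur_t (x t) - load_current (volt (x t))].

Definition u_pbc (Q0 : state -> 'M[R]_(n, n + (m + n))) (x dx : state)
    : 'cV[R]_n :=
  Rs G *m cur_s x + Q0 x *m dx.

(* The feedback involves the time derivative of the state, so the closed loop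
   is an implicit differential equation. *)
Definition closed_loop (Q0 : state -> 'M[R]_(n, n + (m + n)))
    (J : set R) (x : R -> state) (v : R -> 'cV[R]_n) : Prop :=
  dc_network J (fun t => u_pbc Q0 (x t) (derive1 x t) + Ls G *m v t) x.

Definition mixed_potential (x : state) : R :=
  let Is := cur_s x in let It := cur_t x in let V := volt x in
  2^-1 * (It^T *m Rt G *m It) 0 0 + (Is^T *m V) 0 0
  + (It^T *m incidence^T *m V) 0 0
  - (2^-1 * (V^T *m Zlinv G *m V) 0 0 + \sum_i Pl G i 0 * ln (V i 0)
     + ((Il G)^T *m V) 0 0).

Definition potentialA (lam : R) (M : 'M[R]_(n + (m + n))) (x : state) : R :=
  lam * mixed_potential x
  + 2^-1 * ((gradient mixed_potential x)^T *m M
            *m gradient mixed_potential x) 0 0.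

(* Its product with the gradient of the mixed potential is the gradient of
   [potentialA lam M] (for symmetric M). *)
Definition multiplier (lam : R) (M : 'M[R]_(n + (m + n))) (x : state)
    : 'M[R]_(n + (m + n)) :=
  lam%:M + hessian mixed_potential x *m M.

Definition admissible (lam : R) (M : 'M[R]_(n + (m + n))) : Prop :=
  M^T = M /\
  forall x, Xset x -> \rank (multiplier lam M x) = (n + (m + n))%N.

Definition Qmat : 'M[R]_(n + (m + n)) :=
  block_mx (- Ls G) 0 0 (block_mx (- Lt G) 0 0 (Cs G)).

Definition Btilde : 'M[R]_(n + (m + n), n) :=
  (row_mx (- 1%:M) (row_mx (0 : 'M[R]_(n, m)) (0 : 'M[R]_n)))^T.

Definition QA lam M (Q0 : state -> 'M[R]_(n, n + (m + n))) (x : state)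
    : 'M[R]_(n + (m + n)) :=
  multiplier lam M x *m (Qmat - Btilde *m Q0 x).

Definition BA lam M (x : state) : 'M[R]_(n + (m + n), n) :=
  multiplier lam M x *m Btilde *m Ls G.

Definition gradient_system lam M (Q0 : state -> 'M[R]_(n, n + (m + n)))
    (J : set R) (x : R -> state) (v : R -> 'cV[R]_n) : Prop :=
  forall t, J t ->
  QA lam M Q0 (x t) *m derive1 x t
    = gradient (potentialA lam M) (x t) + BA lam M (x t) *m v t.

Definition Q0_robust (ppi : 'cV[R]_n) (x : state) : 'M[R]_(n, n + (m + n)) :=
  row_mx (0 : 'M[R]_n) (row_mx (0 : 'M[R]_(n, m))
    (- (Ls G *m diagv ppi
        *m (invmx (diagv (volt x)) *m invmx (diagv (volt x)))))).

End Network.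

(* [sys J x v]: the trajectory x with input signal v solves the system on J.
   The supply rate is a function of time along a trajectory, because it may
   involve the time derivative of the state. *)
Definition passive (R : realType) (N p : nat) (D : set 'cV[R]_N)
    (sys : set R -> (R -> 'cV[R]_N) -> (R -> 'cV[R]_p) -> Prop)
    (S : 'cV[R]_N -> R)
    (w : (R -> 'cV[R]_N) -> (R -> 'cV[R]_p) -> R -> R) : Prop :=
  (forall x, D x -> 0 <= S x) /\
  forall (J : set R) (x : R -> 'cV[R]_N) (v : R -> 'cV[R]_p),
    time_interval J -> evolves_in D J x -> sys J x v ->
    forall t, J t -> derivable (S \o x) t 1 /\ derive1 (S \o x) t <= w x v t.

(* v^T dV/dt *)
Definition supply_vdV (R : realType) (n m : nat)
    (x : R -> 'cV[R]_(n + (m + n))) (v : R -> 'cV[R]_n) (t : R) : R :=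
  ((v t)^T *m derive1 (@volt R n m \o x) t) 0 0.

(* Main.v *)
(* On the state space the closed loop reads (Q - B~ Q0) x' = grad P + B~ L_s v, and
   grad P_A = (lambda + Hess P M) grad P for symmetric M, so (i) amounts to
   multiplying by an invertible matrix. For (ii) take lambda = 0 and
   M = diag (L_s^{-1}, L_t^{-1}, C_s^{-1}). Then P_A is half the square of grad P
   in the positive definite metric M, and along the closed loop
     dP_A/dt = (M grad P)^T Hess P x'
             = v^T V' - I_t'^T R_t I_t' - V'^T (Z_l^{-1} + (Pi - P_l) [V]^{-2}) V'.

   Gradients, Hessians and time derivatives are all instances of one directional
   derivative of a composite P o c, with c the identity or a trajectory. *)
Require Import Defs.
From mathcomp Require Import all_boot all_order all_algebra.
From mathcomp Require Import all_classical all_reals all_analysis.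
From mathcomp Require Import ring lra.
Import numFieldNormedType.Exports.
Local Open Scope classical_set_scope.
Local Open Scope ring_scope.

Set Implicit Arguments.
Unset Strict Implicit.
Unset Printing Implicit Defensive.

Import Order.TTheory GRing.Theory Num.Theory.

(** * Directional derivatives of matrix-valued maps on a normed space *)

Section DirectionalDerivatives.
Context {R : realType} {V : normedModType R}.
Implicit Types t h : V.

(** Reduces the matrix rules that follow to scalar calculus on the entries. *)
Lemma is_derive_mxP m n (f : V -> 'M[R]_(m, n)) t h (df : 'M[R]_(m, n)) :
  is_derive t h f df <-> forall i j, is_derive t h (fun s => f s i j) (df i j).
Proof.
split=> [[fth <-] i j|df_].
  have fij := (derivable_mxP f t h).1 fth i j.
  by apply: DeriveDef => //; rewrite derive_mx// mxE.
have fth : derivable f t h.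
  by apply/derivable_mxP => i j; apply: (@ex_derive _ _ _ _ _ _ _ (df_ i j)).
apply: DeriveDef => //; rewrite derive_mx//; apply/matrixP => i j; rewrite mxE.
by have [_ ->] := df_ i j.
Qed.

Lemma is_derive_col_mx m1 m2 n (f : V -> 'M[R]_(m1, n)) (g : V -> 'M[R]_(m2, n))
    t h df dg :
  is_derive t h f df -> is_derive t h g dg ->
  is_derive t h (fun s => col_mx (f s) (g s)) (col_mx df dg).
Proof.
move=> /is_derive_mxP Df /is_derive_mxP Dg; apply/is_derive_mxP => i j.
rewrite mxE; case: split_ordP => k ->; under eq_fun do rewrite ?col_mxEu ?col_mxEd.
  exact: Df.
exact: Dg.
Qed.

Lemma is_derive_usubmx m1 m2 n (f : V -> 'M[R]_(m1 + m2, n)) t h df :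
  is_derive t h f df -> is_derive t h (fun s => usubmx (f s)) (usubmx df).
Proof.
move=> /is_derive_mxP Df; apply/is_derive_mxP => i j.
by rewrite mxE; under eq_fun do rewrite mxE; exact: Df.
Qed.

Lemma is_derive_dsubmx m1 m2 n (f : V -> 'M[R]_(m1 + m2, n)) t h df :
  is_derive t h f df -> is_derive t h (fun s => dsubmx (f s)) (dsubmx df).
Proof.
move=> /is_derive_mxP Df; apply/is_derive_mxP => i j.
by rewrite mxE; under eq_fun do rewrite mxE; exact: Df.
Qed.

Lemma is_derive_trmx m n (f : V -> 'M[R]_(m, n)) t h df :
  is_derive t h f df -> is_derive t h (fun s => (f s)^T) df^T.
Proof.
move=> /is_derive_mxP Df; apply/is_derive_mxP => i j.
by rewrite mxE; under eq_fun do rewrite mxE; exact: Df.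
Qed.

Lemma is_derive_mulmx m n p (f : V -> 'M[R]_(m, n)) (g : V -> 'M[R]_(n, p))
    t h df dg :
  is_derive t h f df -> is_derive t h g dg ->
  is_derive t h (fun s => f s *m g s) (df *m g t + f t *m dg).
Proof.
move=> /is_derive_mxP Df /is_derive_mxP Dg; apply/is_derive_mxP => i j.
under eq_fun do rewrite mxE; rewrite !mxE -big_split/=.
rewrite (_ : (fun _ => _) = \sum_k ((fun s => f s i k) * (fun s => g s k j))).
  apply: is_derive_sum => k.
  apply: is_derive_eq (is_deriveM (Df i k) (Dg k j)) _.
  by rewrite addrC; congr (_ + _); exact: mulrC.
by apply/funext => s; rewrite fct_sumE.
Qed.

Lemma is_derive_mulmxl m n p (A : 'M[R]_(m, n)) (f : V -> 'M[R]_(n, p)) t h df :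
  is_derive t h f df -> is_derive t h (fun s => A *m f s) (A *m df).
Proof.
move=> Df; have := is_derive_mulmx (is_derive_cst A t h) Df.
by rewrite mul0mx add0r.
Qed.

(** Restricting [g] to the line through [t] in the direction [h] turns the directional derivative
    into an ordinary one at 0, where the one-variable chain rule applies. *)
Lemma is_derive1_compr (phi : R -> R) (g : V -> R) t h (a b : R) :
  is_derive (g t) 1 phi a -> is_derive t h g b ->
  is_derive t h (fun s => phi (g s)) (a * b).
Proof.
move=> Dphi [gth Dg].
pose gl (s : R) := g (s *: h + t).
have gl0 : gl 0 = g t by rewrite /gl scale0r add0r.
have line (f : V -> R) : (fun s : R => s^-1 *: ((f \o shift t) (s *: h) - f t)) =
   (fun s : R => s^-1 *: (((fun s => f (s *: h + t)) \o shift 0) (s *: 1)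
                         - f (0 *: h + t))).
  apply/funext => s /=.
  by rewrite addr0 [s *: 1]mulr1 scale0r add0r.
have Dgl : is_derive (0 : R) 1 gl b.
  by apply: DeriveDef; rewrite /derivable /derive /gl -line.
rewrite -gl0 in Dphi.
have [cl dl] := is_derive1_comp Dphi Dgl.
by apply: DeriveDef; rewrite /derivable /derive (line (fun s => phi (g s))).
Qed.

End DirectionalDerivatives.

(** * The Euclidean inner product and its derivative *)

Section DotProduct.
Context {R : realType}.

Definition dot k (u v : 'cV[R]_k) : R := (u^T *m v) 0 0.

Lemma dotE k (u v : 'cV[R]_k) : dot u v = \sum_i u i 0 * v i 0.
Proof. by rewrite /dot mxE; apply: eq_bigr => i _; rewrite mxE. Qed.

Lemma dotC k (u v : 'cV[R]_k) : dot u v = dot v u.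
Proof. by rewrite !dotE; apply: eq_bigr => i _; rewrite mulrC. Qed.

Lemma dotDl k (u v w : 'cV[R]_k) : dot (u + v) w = dot u w + dot v w.
Proof. by rewrite /dot raddfD mulmxDl mxE. Qed.

Lemma dotNl k (u w : 'cV[R]_k) : dot (- u) w = - dot u w.
Proof. by rewrite /dot raddfN mulNmx mxE. Qed.

Lemma dotZl k (a : R) (u w : 'cV[R]_k) : dot (a *: u) w = a * dot u w.
Proof. by rewrite /dot linearZ /= -scalemxAl mxE. Qed.

Lemma dotDr k (u v w : 'cV[R]_k) : dot u (v + w) = dot u v + dot u w.
Proof. by rewrite dotC dotDl !(dotC u). Qed.

Lemma dotNr k (u w : 'cV[R]_k) : dot u (- w) = - dot u w.
Proof. by rewrite dotC dotNl dotC. Qed.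

Lemma dot_mulmxl k l (A : 'M[R]_(k, l)) u w : dot (A *m u) w = dot u (A^T *m w).
Proof. by rewrite /dot trmx_mul mulmxA. Qed.

Lemma dot_col_mx k l (u w : 'cV[R]_k) (v z : 'cV[R]_l) :
  dot (col_mx u v) (col_mx w z) = dot u w + dot v z.
Proof. by rewrite /dot tr_col_mx mul_row_col mxE. Qed.

Lemma dot_delta k (u : 'cV[R]_k) i : dot u (delta_mx i 0) = u i 0.
Proof.
rewrite dotE (bigD1 i)//= mxE !eqxx mulr1 big1 ?addr0// => j ji.
by rewrite mxE (negPf ji) mulr0.
Qed.

Lemma is_derive_dot (V : normedModType R) k (f g : V -> 'cV[R]_k) t h df dg :
  is_derive t h f df -> is_derive t h g dg ->
  is_derive t h (fun s => dot (f s) (g s)) (dot df (g t) + dot (f t) dg).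
Proof.
move=> Df Dg.
have /is_derive_mxP/(_ 0 0) := is_derive_mulmx (is_derive_trmx Df) Dg.
by rewrite mxE.
Qed.

(** Symmetry of [A] makes the two terms of the product rule equal, and the factor 1/2 absorbs the
    doubling. *)
Lemma is_derive_quadratic (V : normedModType R) k (A : 'M[R]_k)
    (f : V -> 'cV[R]_k) t h df :
  A^T = A -> is_derive t h f df ->
  is_derive t h (fun s => 2^-1 * dot (f s) (A *m f s)) (dot (A *m f t) df).
Proof.
move=> symA Df; have DAf := is_derive_mulmxl A Df.
apply: is_derive_eq (is_deriveZ 2^-1 (is_derive_dot Df DAf)) _.
rewrite -{2}symA -dot_mulmxl (dotC df) scalerDr.
by rewrite -[RHS]scale1r -scalerDl; congr (_ *: _); rewrite [RHS]splitr div1r.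
Qed.

End DotProduct.

(** * Positive definite and nonnegative diagonal matrices *)

Section PositiveDefinite.
Context {R : realType}.

Lemma unitmx_lker0 k (A : 'M[R]_k) :
  (forall u : 'rV[R]_k, u *m A = 0 -> u = 0) -> A \in unitmx.
Proof.
move=> A0; rewrite -row_free_unit -kermx_eq0; apply/eqP/row_matrixP => i.
by rewrite row0; apply: A0; rewrite -row_mul mulmx_ker row0.
Qed.

Lemma posdef_unitmx k (A : 'M[R]_k) : posdef A -> A \in unitmx.
Proof.
move=> pA; apply: unitmx_lker0 => u uA0; apply/eqP; apply: contraT => u0.
have := pA u^T; rewrite trmxK uA0 mul0mx mxE ltxx; apply.
by rewrite -trmx0 (inj_eq trmx_inj).
Qed.

Lemma tr_is_diag_mx k (A : 'M[R]_k) : is_diag_mx A -> A^T = A.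
Proof. by move=> /diag_mxP[d ->]; rewrite tr_diag_mx. Qed.

Lemma dot_posdef_ge0 k (A : 'M[R]_k) u : posdef A -> 0 <= dot u (A *m u).
Proof.
move=> pA; have [->|u0] := eqVneq u 0.
  by rewrite mulmx0 /dot mulmx0 mxE.
by rewrite /dot mulmxA; apply/ltW/pA.
Qed.

(** Substituting u = A w turns the form of the inverse at u into the form of A at w. *)
Lemma dot_invmx_ge0 k (A : 'M[R]_k) u : posdef A -> 0 <= dot u (invmx A *m u).
Proof.
move=> pA; rewrite -{1}(mulKVmx (posdef_unitmx pA) u) dotC.
have := dot_posdef_ge0 (invmx A *m u) pA.
by rewrite (mulKVmx (posdef_unitmx pA)).
Qed.

Lemma dot_diag_ge0 k (A : 'M[R]_k) u :
  is_diag_mx A -> (forall i, 0 <= A i i) -> 0 <= dot u (A *m u).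
Proof.
move=> /diag_mxP[d ->] d0; rewrite dotE; apply: sumr_ge0 => i _.
rewrite mul_diag_mx mxE mulrCA -expr2 mulr_ge0 ?sqr_ge0//.
by have := d0 i; rewrite mxE eqxx.
Qed.

End PositiveDefinite.

(** * Closed forms of the first and second derivatives of the mixed potential *)

Section Potential.
Context {R : realType} {n m : nat} (G : dc_data R n m).
Notation state := 'cV[R]_(n + (m + n)).
Implicit Types x : state.

Lemma state_split x : x = col_mx (cur_s x) (col_mx (cur_t x) (volt x)).
Proof. by rewrite !vsubmxK. Qed.

(** A finite intersection of open coordinate conditions. It allows identities that hold only on the
    state space to be differentiated. *)
Lemma near_Xset x : Xset x -> \forall y \near x, Xset y.
Proof.
move=> xX.
have near_i (i : 'I_n) : \forall y \near x, 0 < volt y i 0;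
  last exact: filter_forall near_i.
have xi0 : 0 < x (rshift n (rshift m i)) 0 by have := xX i; rewrite !mxE.
have near_pos : \forall r \near x (rshift n (rshift m i)) 0, 0 < r.
  by apply: open_nbhs_nbhs; split => //; exact: open_gt.
near=> y; suff: 0 < y (rshift n (rshift m i)) 0 by rewrite !mxE.
by near: y; exact: (@coord_continuous R _ _ _ _ x _ near_pos).
Unshelve. all: by end_near. Qed.

(** The power-load current is written entrywise instead of with [invmx], so that it can be
    differentiated coordinate by coordinate; [load_currentE] relates the two forms. *)
Definition mixed_gradient x : state :=
  col_mx (volt x)
    (col_mx (Rt G *m cur_t x + (incidence G)^T *m volt x)
       (cur_s x + incidence G *m cur_t x
        - (Zlinv G *m volt x + Il G + \col_i ((volt x i 0)^-1 * Pl G i 0)))).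

(** Minus the Jacobian of the load current. Constant-power loads enter with a nonnegative sign: this
    is what the controller has to dominate. *)
Definition load_hessian x : 'M[R]_n :=
  diag_mx (\row_i ((volt x i 0) ^- 2 * Pl G i 0)) - Zlinv G.

Definition mixed_hessian x : 'M[R]_(n + (m + n)) :=
  block_mx 0 (row_mx 0 1%:M) (col_mx 0 1%:M)
    (block_mx (Rt G) (incidence G)^T (incidence G) (load_hessian x)).

Lemma tr_Rt : (Rt G)^T = Rt G. Proof. exact/tr_is_diag_mx/(Rt_posdef G).1. Qed.

Lemma tr_Zlinv : (Zlinv G)^T = Zlinv G.
Proof. exact/tr_is_diag_mx/(Zlinv_diag G). Qed.

Lemma tr_mixed_hessian x : (mixed_hessian x)^T = mixed_hessian x.
Proof.
rewrite /mixed_hessian tr_block_mx tr_row_mx tr_col_mx tr_block_mx.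
by rewrite !trmx0 !trmx1 trmxK tr_Rt raddfB/= tr_diag_mx tr_Zlinv.
Qed.

Lemma mixed_hessian_col x (a : 'cV[R]_n) (b : 'cV[R]_m) (c : 'cV[R]_n) :
  mixed_hessian x *m col_mx a (col_mx b c) =
  col_mx c (col_mx (Rt G *m b + (incidence G)^T *m c)
              (a + incidence G *m b + load_hessian x *m c)).
Proof.
rewrite /mixed_hessian mul_block_col mul_row_col mul_col_mx !mul0mx !mul1mx.
by rewrite mul_block_col add_col_mx !add0r addrA.
Qed.

Lemma inv_diagv (v : 'cV[R]_n) : (forall i, 0 < v i 0) ->
  invmx (diagv v) = diag_mx (\row_i (v i 0)^-1).
Proof.
move=> v0; have Dv : diagv v *m diag_mx (\row_i (v i 0)^-1) = 1%:M.
  apply/matrixP => i j; rewrite mul_diag_mx !mxE.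
  by case: eqVneq => [->|_]; rewrite ?mulr0n ?mulr0// mulr1n divff// gt_eqF.
have [uD _] := mulmx1_unit Dv.
by rewrite -[RHS](mulKmx uD) Dv mulmx1.
Qed.

Lemma load_currentE x : Xset x ->
  load_current G (volt x)
  = Zlinv G *m volt x + Il G + \col_i ((volt x i 0)^-1 * Pl G i 0).
Proof.
move=> xX; rewrite /load_current inv_diagv//; congr (_ + _).
by apply/colP => i; rewrite mul_diag_mx !mxE.
Qed.

Section AlongDirection.
Variables (V : normedModType R) (c : V -> state) (t h : V) (dc : state).
Hypotheses (cX : Xset (c t)) (Dc : is_derive t h c dc).

Let Ds : is_derive t h (fun s => cur_s (c s)) (cur_s dc).
Proof. exact: is_derive_usubmx. Qed.

Let Dt : is_derive t h (fun s => cur_t (c s)) (cur_t dc).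
Proof. exact/is_derive_usubmx/is_derive_dsubmx. Qed.

Let Dv : is_derive t h (fun s => volt (c s)) (volt dc).
Proof. exact/is_derive_dsubmx/is_derive_dsubmx. Qed.

Lemma is_derive_mixed_potential :
  is_derive t h (fun s => mixed_potential G (c s)) (dot (mixed_gradient (c t)) dc).
Proof.
have DR := is_derive_quadratic tr_Rt Dt.
have DZ := is_derive_quadratic tr_Zlinv Dv.
have DsV := is_derive_dot Ds Dv.
have DtV := is_derive_dot Dt (is_derive_mulmxl (incidence G)^T Dv).
have DI := is_derive_dot (is_derive_cst (Il G) t h) Dv.
have Dln i : is_derive t h (fun s => Pl G i 0 * ln (volt (c s) i 0))
    (Pl G i 0 * ((volt (c t) i 0)^-1 * volt dc i 0)).
  have Dvi := (is_derive_mxP _ _ _ _).1 Dv i 0.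
  exact: is_deriveZ (is_derive1_compr (is_derive1_ln (cX i)) Dvi).
have D := is_deriveB (is_deriveD (is_deriveD DR DsV) DtV)
  (is_deriveD (is_deriveD DZ (is_derive_sum Dln)) DI).
(* The potential is restated as a sum of functions, the form that the derivative rules produce. *)
rewrite (_ : (fun s => _) = (fun s => 2^-1 * dot (cur_t (c s)) (Rt G *m cur_t (c s)))
  + (fun s => dot (cur_s (c s)) (volt (c s)))
  + (fun s => dot (cur_t (c s)) ((incidence G)^T *m volt (c s)))
  - ((fun s => 2^-1 * dot (volt (c s)) (Zlinv G *m volt (c s)))
     + \sum_i (fun s => Pl G i 0 * ln (volt (c s) i 0))
     + (fun s => dot (cst (Il G) s) (volt (c s))))); last first.
  apply/funext => s; rewrite /mixed_potential !fctE/= /dot !mulmxA.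
  by rewrite fct_sumE.
apply: is_derive_eq D _.
rewrite [in RHS](state_split dc) /mixed_gradient !dot_col_mx.
have -> : \sum_i Pl G i 0 * ((volt (c t) i 0)^-1 * volt dc i 0)
    = dot (\col_i ((volt (c t) i 0)^-1 * Pl G i 0)) (volt dc).
  (* The voltages are generalised because [mxE] would otherwise unfold [volt] itself. *)
  rewrite dotE; apply: eq_bigr => i _; move: (volt (c t)) (volt dc) => v dv.
  by rewrite mxE mulrA (mulrC (Pl G i 0)).
have -> : dot (cur_t dc) ((incidence G)^T *m volt (c t))
    = dot ((incidence G)^T *m volt (c t)) (cur_t dc) by exact: dotC.
have -> : dot (cur_s dc) (volt (c t)) = dot (volt (c t)) (cur_s dc) by exact: dotC.
have -> : dot (cur_t (c t)) ((incidence G)^T *m volt dc)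
    = dot (incidence G *m cur_t (c t)) (volt dc) by rewrite dot_mulmxl.
rewrite !(dotDl, dotNl) [dot 0 _](_ : _ = 0); last by rewrite /dot trmx0 mul0mx mxE.
ring.
Qed.

(** Every term is affine in the state except the power-load currents, so only the derivative of
    1/V_i needs separate work. *)
Lemma is_derive_mixed_gradient :
  is_derive t h (fun s => mixed_gradient (c s)) (mixed_hessian (c t) *m dc).
Proof.
have DP : is_derive t h (fun s => \col_i ((volt (c s) i 0)^-1 * Pl G i 0))
    (- (diag_mx (\row_i ((volt (c t) i 0) ^- 2 * Pl G i 0)) *m volt dc)).
  apply/is_derive_mxP => i j; rewrite ord1 {j}.
  have Dvi := (is_derive_mxP _ _ _ _).1 Dv i 0.
  have vi0 : volt (c t) i 0 != 0 by rewrite gt_eqF.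
  have Dinv : is_derive t h (fun s => (volt (c s) i 0)^-1)
      (- (volt (c t) i 0) ^- 2 *: volt dc i 0).
    have [dv <-] := Dvi.
    by apply: DeriveDef; [exact: derivableV|exact: deriveV].
  under eq_fun do rewrite mxE mulrC.
  apply: is_derive_eq (is_deriveZ (Pl G i 0) Dinv) _.
  move: (volt (c t)) (volt dc) => v dv.
  rewrite mul_diag_mx !mxE -[LHS]/(Pl G i 0 * (- v i 0 ^- 2 * dv i 0)).
  by rewrite mulNr mulrN mulrCA mulrA.
have DB := is_derive_mulmxl (incidence G) Dt.
have DBT := is_derive_mulmxl (incidence G)^T Dv.
have DR := is_derive_mulmxl (Rt G) Dt.
have DZ := is_derive_mulmxl (Zlinv G) Dv.
have D3 := is_deriveB (is_deriveD Ds DB)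
  (is_deriveD (is_deriveD DZ (is_derive_cst (Il G) t h)) DP).
have D := is_derive_col_mx Dv (is_derive_col_mx (is_deriveD DR DBT) D3).
apply: is_derive_eq D _.
rewrite [in RHS](state_split dc) mixed_hessian_col /load_hessian mulmxBl addr0.
by rewrite opprD opprK [X in _ + _ + X]addrC.
Qed.

End AlongDirection.
End Potential.

(** * The gradients and the Hessian of the statement in closed form *)

Section ClosedForms.
Context {R : realType} {n m : nat} (G : dc_data R n m).
Notation state := 'cV[R]_(n + (m + n)).
Implicit Types x : state.

Lemma partial_mixed_potential x i : Xset x ->
  'D_(delta_mx i 0) (mixed_potential G) x = mixed_gradient G x i 0.
Proof.
move=> xX; have [_ D] :=
  is_derive_mixed_potential G xX (is_derive_id x (delta_mx i 0)).
by rewrite -dot_delta -D.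
Qed.

Lemma gradient_mixed_potential x : Xset x ->
  gradient (mixed_potential G) x = mixed_gradient G x.
Proof. by move=> xX; apply/colP => i; rewrite mxE partial_mixed_potential. Qed.

Lemma hessian_mixed_potential x : Xset x ->
  hessian (mixed_potential G) x = mixed_hessian G x.
Proof.
move=> xX; apply/matrixP => i j; rewrite mxE.
have Dj : is_derive x (delta_mx i 0) (fun y => mixed_gradient G y j 0)
    (mixed_hessian G x i j).
  have := (is_derive_mxP _ _ _ _).1
    (is_derive_mixed_gradient G xX (is_derive_id x (delta_mx i 0))) j 0.
  (* The i-th basis vector selects column i, hence entry (j, i); symmetry turns it into entry (i,
     j). *)
  by rewrite -colE mxE -[in X in X -> _](tr_mixed_hessian G x) mxE.
(* The closed form of the partial derivative holds only on the state space, but this is a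
   neighbourhood of [x], which suffices for the derivative. *)
rewrite -(@derive_val _ _ _ _ _ _ _ Dj); apply: near_eq_derive.
have := near_Xset xX.
by apply: filterS => y yX; exact: partial_mixed_potential.
Qed.

Variables (lam : R) (M : 'M[R]_(n + (m + n))).
Hypothesis MT : M^T = M.

Lemma potentialAE x : Xset x ->
  potentialA G lam M x =
  lam * mixed_potential G x
  + 2^-1 * dot (mixed_gradient G x) (M *m mixed_gradient G x).
Proof. by move=> xX; rewrite /potentialA gradient_mixed_potential// /dot mulmxA. Qed.

Lemma multiplierE x : Xset x ->
  multiplier G lam M x = lam%:M + mixed_hessian G x *m M.
Proof. by move=> xX; rewrite /multiplier hessian_mixed_potential. Qed.

(** Continuity of [c] keeps it in the state space near [t], where [potentialAE] applies. Symmetry of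
    the Hessian then moves it to the left factor, which produces the multiplier. *)
Lemma is_derive_potentialA (V : normedModType R) (c : V -> state) t h dc :
  {for t, continuous c} -> Xset (c t) -> is_derive t h c dc ->
  is_derive t h (fun s => potentialA G lam M (c s))
    (dot (multiplier G lam M (c t) *m mixed_gradient G (c t)) dc).
Proof.
move=> cc cX Dc.
pose PA y := lam * mixed_potential G y
  + 2^-1 * dot (mixed_gradient G y) (M *m mixed_gradient G y).
have nX : \forall s \near t, PA (c s) = potentialA G lam M (c s).
  have : \forall s \near t, Xset (c s) by exact: cc (near_Xset cX).
  by apply: filterS => s sX; rewrite potentialAE.
apply: near_eq_is_derive nX _.
have D := is_deriveD (is_deriveZ lam (is_derive_mixed_potential G cX Dc))
  (is_derive_quadratic MT (is_derive_mixed_gradient G cX Dc)).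
apply: is_derive_eq D _.
rewrite multiplierE// mulmxDl mul_scalar_mx dotDl dotZl -mulmxA.
by rewrite [dot (mixed_hessian _ _ *m _) _]dot_mulmxl tr_mixed_hessian.
Qed.

Lemma gradient_potentialA x : Xset x ->
  gradient (potentialA G lam M) x = multiplier G lam M x *m mixed_gradient G x.
Proof.
move=> xX; apply/colP => i; rewrite mxE -[RHS]dot_delta.
have cid : {for x, continuous (@id state)} by [].
by have [_] := is_derive_potentialA cid xX (is_derive_id x (delta_mx i 0)).
Qed.

End ClosedForms.

(** * The closed loop as a single vector equation *)

Section ClosedLoop.
Context {R : realType} {n m : nat} (G : dc_data R n m).
Notation state := 'cV[R]_(n + (m + n)).
Variables (Q0 : state -> 'M[R]_(n, n + (m + n))) (J : set R).
Variables (x : R -> state) (v : R -> 'cV[R]_n).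
Hypothesis xX : evolves_in (@Xset R n m) J x.

Lemma derive1_state t : J t ->
  [/\ derive1 (@cur_s R n m \o x) t = cur_s (derive1 x t),
      derive1 (@cur_t R n m \o x) t = cur_t (derive1 x t) &
      derive1 (@volt R n m \o x) t = volt (derive1 x t)].
Proof.
move=> /xX[/derivableP Dx _]; rewrite !derive1E.
have Dd := is_derive_dsubmx Dx.
split; first by have [_] := is_derive_usubmx Dx.
  by have [_] := is_derive_usubmx Dd.
by have [_] := is_derive_dsubmx Dd.
Qed.

Definition loop_eq t :=
  (Qmat G - Btilde R n m *m Q0 (x t)) *m derive1 x t
    = mixed_gradient G (x t) + Btilde R n m *m Ls G *m v t.

Lemma mul_Qmat (z : state) : Qmat G *m z =
  col_mx (- (Ls G *m cur_s z))
    (col_mx (- (Lt G *m cur_t z)) (Cs G *m volt z)).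
Proof.
rewrite [in LHS](state_split z) /Qmat !mul_block_col !mul0mx !add0r.
by rewrite !addr0 !mulNmx.
Qed.

Lemma mul_Btilde (w : 'cV[R]_n) :
  Btilde R n m *m w = col_mx (- w) (col_mx 0 0).
Proof.
rewrite /Btilde !tr_row_mx !trmx0 raddfN/= trmx1 !mul_col_mx !mul0mx.
by rewrite mulNmx mul1mx.
Qed.

Lemma closed_loopP : closed_loop G Q0 J x v <-> forall t, J t -> loop_eq t.
Proof.
suff equiv t : J t -> ([/\ - (Ls G *m derive1 (@cur_s R n m \o x) t)
        = Rs G *m cur_s (x t) + volt (x t)
          - (u_pbc G Q0 (x t) (derive1 x t) + Ls G *m v t),
      - (Lt G *m derive1 (@cur_t R n m \o x) t)
        = Rt G *m cur_t (x t) + (incidence G)^T *m volt (x t) &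
      Cs G *m derive1 (@volt R n m \o x) t
        = cur_s (x t) + incidence G *m cur_t (x t) - load_current G (volt (x t))]
  <-> loop_eq t).
  by split=> H t Jt; apply/equiv => //; exact: H.
move=> Jt; have [-> -> ->] := derive1_state Jt; have [_ xtX] := xX Jt.
rewrite load_currentE// /loop_eq mulmxBl -!mulmxA /u_pbc.
rewrite mul_Qmat !mul_Btilde !opp_col_mx !oppr0 !opprK /mixed_gradient
  !add_col_mx !addr0.
(* The source row, with a = -L_s I_s', r = R_s I_s, w = V, q = Q_0 x' and l = L_s v: the feedback
   R_s I_s cancels the resistive drop. The other two rows already agree. *)
have e1 (a r w q l : 'cV[R]_n) :
    a = r + w - (r + q + l) <-> a + q = w - l.
  rewrite -(addrA r q) opprD addrACA subrr add0r opprD addrA addrAC.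
  by split=> [->|<-]; rewrite ?subrK ?addrK.
split=> [[/e1 -> -> ->]//|/eq_col_mx[E1 /eq_col_mx[E2 E3]]].
by split=> //; apply/e1.
Qed.

End ClosedLoop.

(** * Equivalence with the gradient structure, and passivity *)

Section Passivity.
Context {R : realType} {n m : nat} (G : dc_data R n m).
Notation state := 'cV[R]_(n + (m + n)).

Lemma closed_loop_gradient_system Q0 lam M J x (v : R -> 'cV[R]_n) :
  admissible G lam M -> evolves_in (@Xset R n m) J x ->
  closed_loop G Q0 J x v <-> gradient_system G lam M Q0 J x v.
Proof.
move=> [MT fullN] xX; rewrite closed_loopP//.
suff equiv t : J t -> loop_eq G Q0 x v t <->
    QA G lam M Q0 (x t) *m derive1 x t
    = gradient (potentialA G lam M) (x t) + BA G lam M (x t) *m v t.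
  by split=> H t Jt; apply/equiv => //; exact: H.
move=> /xX[_ xtX]; rewrite gradient_potentialA// /QA /BA -!mulmxA -mulmxDr.
(* Invertibility allows the multiplier to be cancelled in the converse direction. *)
have uN : multiplier G lam M (x t) \in unitmx.
  by rewrite -row_free_unit /row_free fullN.
rewrite /loop_eq -mulmxA.
by split=> [->|/(can_inj (mulKmx uN))].
Qed.

(* The supply rate v^T dV/dt asks for B_A = - (0, 0, 1)^T; when some power load is
   nonzero, the voltage-voltage block of the Hessian varies with V, which forces
   lambda = 0 and the first block column (L_s^{-1}, 0, 0)^T of M. The other two blocks are chosen
   so that the cross terms in I_s', V' and in I_t', V' cancel. *)
Definition Qabs_inv : 'M[R]_(n + (m + n)) :=
  block_mx (invmx (Ls G)) 0 0 (block_mx (invmx (Lt G)) 0 0 (invmx (Cs G))).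

Lemma Qabs_inv_col (a : 'cV[R]_n) (b : 'cV[R]_m) (c : 'cV[R]_n) :
  Qabs_inv *m col_mx a (col_mx b c) =
  col_mx (invmx (Ls G) *m a) (col_mx (invmx (Lt G) *m b) (invmx (Cs G) *m c)).
Proof. by rewrite /Qabs_inv !mul_block_col !mul0mx !addr0 !add0r. Qed.

Lemma tr_Qabs_inv : Qabs_inv^T = Qabs_inv.
Proof.
rewrite /Qabs_inv !tr_block_mx !trmx0 !trmx_inv.
rewrite !tr_is_diag_mx//;
  by [case: (Cs_posdef G)|case: (Lt_posdef G)|case: (Ls_posdef G)].
Qed.

Lemma Qabs_inv_unit : Qabs_inv \in unitmx.
Proof.
have uLs := posdef_unitmx (Ls_posdef G).2.
have uLt := posdef_unitmx (Lt_posdef G).2.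
have uCs := posdef_unitmx (Cs_posdef G).2.
suff /mulmx1_unit[] : Qabs_inv *m
  block_mx (Ls G) 0 0 (block_mx (Lt G) 0 0 (Cs G)) = 1%:M by [].
rewrite /Qabs_inv !mulmx_block !(mulmx0, mul0mx, addr0, add0r).
by rewrite !mulVmx// -!scalar_mx_block.
Qed.

(** For lambda = 0 the full-rank condition rests on this. On a kernel vector (a, b, c) the first row
    gives c = 0, the second R_t b = 0 and so b = 0, and the third a = 0. *)
Lemma mixed_hessian_unit (x : state) : mixed_hessian G x \in unitmx.
Proof.
apply: unitmx_lker0 => u uH0; apply: trmx_inj; rewrite trmx0.
have : mixed_hessian G x *m u^T = 0.
  by rewrite -[mixed_hessian G x]tr_mixed_hessian -trmx_mul uH0 trmx0.
rewrite (state_split u^T); move: (cur_s _) (cur_t _) (volt _) => a b c.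
rewrite mixed_hessian_col -[0 in X in X -> _]vsubmxK -[dsubmx 0]vsubmxK.
move=> /eq_col_mx[].
rewrite !raddf0 => -> /eq_col_mx[]; rewrite !mulmx0 !addr0 => Rb0.
have -> : b = 0.
  by rewrite -(mulKmx (posdef_unitmx (Rt_posdef G).2) b) Rb0 mulmx0.
by rewrite mulmx0 addr0 => ->; rewrite !col_mx0.
Qed.

Lemma Qabs_inv_admissible : admissible G 0 Qabs_inv.
Proof.
split=> [|x xX]; first exact: tr_Qabs_inv.
rewrite multiplierE// -scalemx1 scale0r add0r mxrank_unit//.
by rewrite unitmx_mul mixed_hessian_unit Qabs_inv_unit.
Qed.

Lemma potentialA_ge0 (x : state) : Xset x -> 0 <= potentialA G 0 Qabs_inv x.
Proof.
move=> xX; rewrite potentialAE// mul0r add0r mulr_ge0 ?invr_ge0 ?ler0n//.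
rewrite (state_split (mixed_gradient G x)) Qabs_inv_col !dot_col_mx !addr_ge0//.
- exact: dot_invmx_ge0 (Ls_posdef G).2.
- exact: dot_invmx_ge0 (Lt_posdef G).2.
- exact: dot_invmx_ge0 (Cs_posdef G).2.
Qed.

(** Entrywise P_l / V^2 is at most pi / V^2, and the impedance part only lowers the left side. This
    is where the bound on the power loads enters. *)
Lemma load_hessian_le_robust (ppi : 'cV[R]_n) (x : state) (w : 'cV[R]_n) :
  (forall i, Pl G i 0 <= ppi i 0) -> Xset x ->
  dot w (load_hessian G x *m w) <=
  dot (diagv ppi *m (invmx (diagv (volt x)) *m invmx (diagv (volt x))) *m w) w.
Proof.
move=> Pl_ppi xX; rewrite /load_hessian mulmxBl dotDr dotNr lerBlDr.
rewrite -[leLHS]addr0 lerD//; last exact: dot_diag_ge0 (Zlinv_diag G) (Zlinv_ge0 G).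
rewrite dotC inv_diagv// !dotE; apply: ler_sum => i _.
rewrite -!mulmxA !mul_diag_mx; have := xX i; move: (volt x) => V Vi0.
rewrite !mxE; set W := w i 0; set v := V i 0 in Vi0 *.
rewrite -[leLHS]mulrA -expr2.
have -> : ppi i 0 * (v^-1 * (v^-1 * W)) * W = v ^- 2 * ppi i 0 * W ^+ 2.
  by field; rewrite gt_eqF.
by rewrite ler_wpM2r ?sqr_ge0// ler_wpM2l// invr_ge0 exprn_ge0// ltW.
Qed.

Lemma power_balance (ppi : 'cV[R]_n) (x : R -> state) (v : R -> 'cV[R]_n) t :
  (forall i, Pl G i 0 <= ppi i 0) -> Xset (x t) ->
  loop_eq G (Q0_robust G ppi) x v t ->
  dot (multiplier G 0 Qabs_inv (x t) *m mixed_gradient G (x t)) (derive1 x t)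
  <= dot (v t) (volt (derive1 x t)).
Proof.
move=> Pl_ppi xtX; rewrite /loop_eq mulmxBl -!mulmxA.
rewrite multiplierE// -scalemx1 scale0r add0r -mulmxA dot_mulmxl tr_mixed_hessian.
(* The loop equation is solved for grad P, which is thereby expressed through x' and v. *)
rewrite mul_Qmat !mul_Btilde => /esym/(canRL (addrK _)) ->.
rewrite !opp_col_mx !oppr0 !opprK !add_col_mx !addr0.
have qE : Q0_robust G ppi (x t) *m derive1 x t =
    - (Ls G *m (diagv ppi *m
        (invmx (diagv (volt (x t))) *m invmx (diagv (volt (x t))))
        *m volt (derive1 x t))).
  rewrite [in LHS](state_split (derive1 x t)) /Q0_robust !mul_row_col.
  by rewrite !mul0mx !add0r mulNmx -!mulmxA.
have := load_hessian_le_robust (volt (derive1 x t)) Pl_ppi xtX.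
rewrite qE [in mixed_hessian _ _ *m _](state_split (derive1 x t)).
rewrite mixed_hessian_col Qabs_inv_col.
set D := diagv ppi *m _; move: (cur_s _) (cur_t _) (volt _) => a b w damping.
have [uLs uLt uCs] := And3 (posdef_unitmx (Ls_posdef G).2)
  (posdef_unitmx (Lt_posdef G).2) (posdef_unitmx (Cs_posdef G).2).
(* With x' = (a, b, w), the product M grad P becomes (v - a - D w, -b, w). *)
rewrite !(mulmxDr, mulmxN) !mulKmx//.
rewrite !dot_col_mx !(dotDl, dotDr, dotNl) -(dot_mulmxl _ b).
have := dot_posdef_ge0 b (Rt_posdef G).2.
(* Once symmetric products are identified, the cross terms cancel and the claim is linear in the
   inner products: the line losses and [damping] close it. *)
move: damping; rewrite (dotC w a) (dotC w (incidence G *m b)).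
lra.
Qed.

End Passivity.

Theorem theorem2 (R : realType) (n m : nat) (G : dc_data R n m)
    (ppi : 'cV[R]_n)
    (ppi_ge0 : forall i, 0 <= ppi i 0)
    (Pl_le_ppi : forall i, Pl G i 0 <= ppi i 0) :
  (forall (Q0 : 'cV[R]_(n + (m + n)) -> 'M[R]_(n, n + (m + n)))
          (lam : R) (M : 'M[R]_(n + (m + n))),
     admissible G lam M ->
     forall (J : set R) (x : R -> 'cV[R]_(n + (m + n))) (v : R -> 'cV[R]_n),
       time_interval J -> evolves_in (@Xset R n m) J x ->
       (closed_loop G Q0 J x v <-> gradient_system G lam M Q0 J x v))
  /\
  (exists (lam : R) (M : 'M[R]_(n + (m + n))),
     admissible G lam M /\
     passive (@Xset R n m) (closed_loop G (Q0_robust G ppi))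
       (potentialA G lam M) (@supply_vdV R n m)).
Proof.
split=> [Q0 lam M admM J x v _ xX|]; first exact: closed_loop_gradient_system.
exists 0, (Qabs_inv G); split; first exact: Qabs_inv_admissible.
split=> [x|J x v _ xX]; first exact: potentialA_ge0.
rewrite closed_loopP// => loop t Jt; have [dxt xtX] := xX t Jt.
(* In one real variable derivability gives continuity, as [is_derive_potentialA] requires. *)
have xt_cont : {for t, continuous x}.
  exact/differentiable_continuous/derivable1_diffP.
have [dS dSE] :=
  is_derive_potentialA G 0 (tr_Qabs_inv G) xt_cont xtX (derivableP dxt).
split=> //; rewrite derive1E dSE /supply_vdV -/(dot _ _) -derive1E.
have [_ _ ->] := derive1_state xX Jt.
by apply: power_balance Pl_le_ppi xtX (loop t Jt).
Qed.
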